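(* Let $\hat f^{(m)}=(\hat f^{(m)}_0,\dots,\hat f^{(m)}_M)^T:[0,\infty)\to\mathbb{C}^{M+1}$, $m\geq 1$, be the solutions of $$\frac{\mathrm{d}\hat f^{(1)}}{\mathrm{d}t}+\mathrm{i}k\Big(A+\frac{1}{k^2}G\Big)\hat f^{(1)}=H\hat f^{(1)},\qquad \hat f^{(1)}(0)=(1,0,\dots,0)^T,$$ and, for $m\geq 2$, $$\frac{\mathrm{d}\hat f^{(m)}}{\mathrm{d}t}+\mathrm{i}mk\Big(A+\frac{1}{(mk)^2}G\Big)\hat f^{(m)}+\frac{\mathrm{i}}{k}\sum_{l=1}^{m-1}\frac1l\hat f^{(l)}_0 B\hat f^{(m-l)}=H\hat f^{(m)},\qquad \hat f^{(m)}(0)=0.$$ Then for each positive integer $m$ there exists a constant $K^{(m)}$ such that $$\|\hat f^{(m)}(t)\|_2\leq K^{(m)}(t^M+1)\exp(-\lambda^{(1)}t)\qquad\text{for all } t\geq 0.$$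
   Context: Let $M \geq 1$ be an integer, $D>0$ and $k = 2\pi/D$. Rows and columns of $(M+1)\times(M+1)$ matrices are indexed from $1$ to $M+1$. The matrix $A$ is the real symmetric tridiagonal matrix with zero diagonal and $A_{n,n+1}=A_{n+1,n}=\sqrt{n}$, $n=1,\dots,M$; the matrix $B$ has entries $B_{n+1,n}=\sqrt{n}$, $n=1,\dots,M$, and all other entries zero; the matrix $G$ has its entry in the second row and first column equal to $1$ and all other entries zero. The filter matrix $H = \mathrm{diag}\{h_0,h_1,\dots,h_M\}$ is real diagonal with $h_i \leq 0$ for all $i$, $h_0 = 0$ and $h_M\neq 0$. $\|\cdot\|_2$ is the Euclidean norm of vectors and the induced spectral norm of matrices. For $m\in\mathbb{Z}\setminus\{0\}$ let $G_m=-\mathrm{i}mk\big(A+\frac{1}{(mk)^2}G\big)+H$. The constant $\lambda^{(1)}>0$ is a constant, independent of $m$, such that for all $m\in\mathbb{Z}\setminus\{0\}$ all eigenvalues of $G_m$ have real parts less than $-\lambda^{(1)}$ and, for some constant $C^{(4)}$ independent of $m$ and $t$, $\|\exp(tG_m)\|_2\leq C^{(4)}(t^M+1)\exp(-\lambda^{(1)}t)$ for all $t\geq 0$. *)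

(* Defs.v *)
From HB Require Import structures.
From mathcomp Require Import all_boot all_order all_algebra.
From mathcomp Require Import all_classical all_reals all_analysis.
From mathcomp Require Import complex.

Set Implicit Arguments.
Unset Strict Implicit.
Unset Printing Implicit Defensive.

Import Order.TTheory GRing.Theory Num.Theory.
Import numFieldNormedType.Exports.

Local Open Scope classical_set_scope.
Local Open Scope complex_scope.
Local Open Scope ring_scope.

(* R[i] as a normed module over itself, with the topology of its modulus;
   matrices over R[i] then carry the entrywise topology. *)
HB.instance Definition _ (R : realType) := NormedModule.copy R[i] R[i]^o.

Section Norms.
Variable R : realType.

Definition norm2 n (v : 'cV[R[i]]_n) : R :=
  Num.sqrt (\sum_(j < n) ComplexField.Normc.normc (v j ord0) ^+ 2).

(* The set is nonempty (for n > 0) and bounded, so [sup] is a true supremum. *)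
Definition mxnorm2 n (X : 'M[R[i]]_n) : R :=
  sup [set norm2 (X *m v) | v in [set v : 'cV[R[i]]_n | norm2 v = 1]].

(* The limit of the partial sums of the exponential series. [lim] is a total
   function, but this limit exists for every X. *)
Definition expmx n (X : 'M[R[i]]_n.+1) : 'M[R[i]]_n.+1 :=
  lim (series (fun p : nat => (p`!%:R)^-1 *: X ^+ p) @ \oo).

End Norms.

Section HalfLineDerivative.
Variables (R : realType) (n : nat).
Implicit Types (f : R -> 'cV[R[i]]_n) (t : R).

(* For t >= 0, increments are restricted to those keeping t + h in [0, +oo):
   the derivative is one-sided at t = 0, two-sided at t > 0, and values of f
   at negative times are irrelevant. *)
Definition diff_quotient f t : R -> 'cV[R[i]]_n :=
  fun h => (h^-1)%:C *: (f (t + h) - f t).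

Definition increments t : set_system R := within [set h | 0 <= t + h] 0^'.

Definition derivable_ge0 f t : Prop := cvg (diff_quotient f t @ increments t).

Definition derive_ge0 f t : 'cV[R[i]]_n := lim (diff_quotient f t @ increments t).

End HalfLineDerivative.

Section Matrices.
Variables (R : realType) (M : nat).

(* Ordinals start at 0, so the entry (n, n+1) for 1-based n is at (n-1, n). *)
Definition mxA : 'M[R[i]]_M.+1 :=
  \matrix_(i, j) (if j == i.+1 :> nat then Num.sqrt (i.+1)%:R
                  else if i == j.+1 :> nat then Num.sqrt (j.+1)%:R
                  else 0)%:C.

Definition mxB : 'M[R[i]]_M.+1 :=
  \matrix_(i, j) (if i == j.+1 :> nat then Num.sqrt (j.+1)%:R else 0)%:C.

Definition mxG : 'M[R[i]]_M.+1 :=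
  \matrix_(i, j) (if (i == 1 :> nat) && (j == 0 :> nat) then 1 else 0).

Definition mxH (h : 'I_M.+1 -> R) : 'M[R[i]]_M.+1 :=
  diag_mx (\row_j (h j)%:C).

Definition mxGm (k : R) (h : 'I_M.+1 -> R) (m : int) : 'M[R[i]]_M.+1 :=
  - ('i%C * (m%:~R * k)%:C) *: (mxA + (((m%:~R * k) ^+ 2)^-1)%:C *: mxG) + mxH h.

End Matrices.

(* Main.v *)
Require Import Defs.
From HB Require Import structures.
From mathcomp Require Import all_boot all_order all_algebra.
From mathcomp Require Import all_classical all_reals all_analysis.
From mathcomp Require Import complex ring lra.

Set Implicit Arguments.
Unset Strict Implicit.
Unset Printing Implicit Defensive.

Import Order.TTheory GRing.Theory Num.Theory.
Import numFieldNormedType.Exports.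

Local Open Scope classical_set_scope.
Local Open Scope complex_scope.
Local Open Scope ring_scope.

(* Write G for the generator of mode m, g for the convolution term moved to the
   right-hand side and lambda for the decay rate. By induction on m,
   |g(s)| <= c (s^M + 1)^2 e^(-2 lambda s) <= c' e^(-3/2 lambda s). For fixed t,
   the curve phi(s) = exp((t-s)G) f(s) runs from exp(tG) f(0) to f(t), and
   phi'(s) = exp((t-s)G) g(s) has norm at most
   c'' (t^M + 1) e^(-lambda t) e^(-lambda s / 2): the factor e^(-lambda t) comes
   out and what remains is integrable on [0, oo). The increment of phi is bounded
   by comparing each real coordinate with a multiple of e^(-lambda s / 2), so that
   no vector-valued integral is needed. *)

(** * Power series with coefficients [a p / p!] and their derivatives *)

Section ExponentialGeneratingFunction.
Variable R : realType.
Implicit Types (a : nat -> R) (x : R).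

(** A growth condition that makes the series converge on the whole line. It survives shifting the
    sequence, and the entries of the powers of a matrix satisfy it. No sign is imposed on [K] and
    [L]. *)
Definition geom_bounded a := exists K L : R, forall p, `|a p| <= K * L ^+ p.

Definition egf_coeff a : nat -> R := fun p => (p`!%:R)^-1 * a p.

Definition egf a x : R := limn (pseries (egf_coeff a) x).

Lemma geom_bounded_shift a : geom_bounded a -> geom_bounded (fun p => a p.+1).
Proof. by move=> [K [L aKL]]; exists (K * L), L => p; rewrite -mulrA -exprS. Qed.

(** Absolute convergence, by comparison with the series of |K| exp(|L| |x|). *)
Lemma is_cvg_egf a x : geom_bounded a -> cvgn (pseries (egf_coeff a) x).
Proof.
move=> [K [L aKL]]; apply: normed_cvg.
apply: (@series_le_cvg _ _ (`|K| *: exp_coeff (`|L| * `|x|))).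
- by move=> p; rewrite normr_ge0.
- move=> p; apply: (mulr_ge0 (normr_ge0 K)).
  by apply: exp_coeff_ge0; apply: mulr_ge0.
- move=> p; rewrite /egf_coeff /= !normrM normfV normr_nat normrX.
  rewrite [leRHS](_ : _ = p`!%:R^-1 * (`|K| * `|L| ^+ p) * `|x| ^+ p).
    rewrite ler_wpM2r ?exprn_ge0 // ler_wpM2l ?invr_ge0 //.
    by rewrite (le_trans (aKL p)) // (le_trans (ler_norm _)) // normrM normrX.
  rewrite [LHS](_ : _ = `|K| * ((`|L| * `|x|) ^+ p / p`!%:R)) // exprMn.
  by ring.
- by apply: is_cvg_seriesZ; exact: is_cvg_series_exp_coeff.
Qed.

(** Since (p+1)/(p+1)! = 1/p!, termwise differentiation just shifts the sequence. *)
Lemma pseries_diffs_egf a :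
  pseries_diffs (egf_coeff a) = egf_coeff (fun p => a p.+1).
Proof.
apply/funext => p; rewrite /pseries_diffs /egf_coeff factS natrM invfM !mulrA.
by rewrite mulfV ?mul1r // pnatr_eq0.
Qed.

(** Termwise differentiation asks the series and its first two formal derivatives to converge at a
    point of modulus larger than |x|; |x| + 1 serves, all three being series of shifts of [a]. *)
Lemma is_derive_egf a x : geom_bounded a ->
  is_derive x (1 : R) (egf a) (egf (fun p => a p.+1) x).
Proof.
move=> ga; rewrite /egf -pseries_diffs_egf.
apply: (@pseries_snd_diffs _ _ (`|x| + 1)).
- exact: is_cvg_egf.
- by rewrite pseries_diffs_egf; apply/is_cvg_egf/geom_bounded_shift.
- rewrite !pseries_diffs_egf.
  apply: is_cvg_egf.
  exact: geom_bounded_shift (geom_bounded_shift ga).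
- by rewrite [ltRHS]ger0_norm ?addr_ge0 // ltrDl.
Qed.

End ExponentialGeneratingFunction.

(** * Complex limits and derivatives through real and imaginary parts *)

Section ComplexTopology.
Variable R : realType.
Implicit Types (z w l : R[i]).

Local Notation Re := (@complex.Re R).
Local Notation Im := (@complex.Im R).
Local Notation normc := (@ComplexField.Normc.normc R).

Lemma ReM z w : Re (z * w) = Re z * Re w - Im z * Im w.
Proof. by case: z w => a b [c d]. Qed.

Lemma ImM z w : Im (z * w) = Re z * Im w + Im z * Re w.
Proof. by case: z w => a b [c d]. Qed.

Lemma ReD z w : Re (z + w) = Re z + Re w.
Proof. by case: z w => a b [c d]. Qed.

Lemma ImD z w : Im (z + w) = Im z + Im w.
Proof. by case: z w => a b [c d]. Qed.

Lemma ReB z w : Re (z - w) = Re z - Re w.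
Proof. by case: z w => a b [c d]. Qed.

Lemma ImB z w : Im (z - w) = Im z - Im w.
Proof. by case: z w => a b [c d]. Qed.

Lemma Re_sum I (r : seq I) (P : pred I) (F : I -> R[i]) :
  Re (\sum_(i <- r | P i) F i) = \sum_(i <- r | P i) Re (F i).
Proof. exact: (big_morph _ ReD). Qed.

Lemma Im_sum I (r : seq I) (P : pred I) (F : I -> R[i]) :
  Im (\sum_(i <- r | P i) F i) = \sum_(i <- r | P i) Im (F i).
Proof. exact: (big_morph _ ImD). Qed.

Lemma normr_Re_le_normc z : `|Re z| <= normc z.
Proof.
case: z => a b /=; rewrite -sqrtr_sqr ler_sqrt ?addr_ge0 ?sqr_ge0 //.
by rewrite lerDl sqr_ge0.
Qed.

Lemma normr_Im_le_normc z : `|Im z| <= normc z.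
Proof.
case: z => a b /=; rewrite -sqrtr_sqr ler_sqrt ?addr_ge0 ?sqr_ge0 //.
by rewrite lerDr sqr_ge0.
Qed.

Lemma normc_ge0 z : 0 <= normc z.
Proof. exact: le_trans (normr_ge0 _) (normr_Re_le_normc z). Qed.

Lemma normc_le z : normc z <= `|Re z| + `|Im z|.
Proof.
case: z => a b /=; rewrite -[leRHS]ger0_norm ?addr_ge0 // -sqrtr_sqr.
rewrite ler_sqrt ?sqr_ge0 // sqrrD !real_normK ?num_real //.
by rewrite -addrA lerD2l lerDr mulrn_wge0 // mulr_ge0.
Qed.

Lemma normc_real (x : R) : normc x%:C = `|x|.
Proof. by rewrite /= expr0n addr0 sqrtr_sqr. Qed.

Lemma cvg_complexP (T : Type) (F : set_system T) (FF : Filter F)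
    (u : T -> R[i]) l :
  u @ F --> l <->
  (Re (u x) @[x --> F] --> Re l) /\
  (Im (u x) @[x --> F] --> Im l).
Proof.
split.
- move=> /cvgrPdist_lt ul; split; apply/cvgrPdist_lt => e e0;
  (have := ul e%:C; rewrite ltcR => /(_ e0); apply: filterS => x);
  rewrite normc_def ltcR -/(normc (_ +i* _)).
  + move=> h; apply: le_lt_trans h; rewrite -ReB.
    by have := normr_Re_le_normc (l - u x); case: (l - u x).
  + move=> h; apply: le_lt_trans h; rewrite -ImB.
    by have := normr_Im_le_normc (l - u x); case: (l - u x).
- move=> [/cvgrPdist_lt ur /cvgrPdist_lt ui]; apply/cvgrPdist_lt => -[e e'].
  (* A positive element of [R[i]] has zero imaginary part, so the tolerance is a real number. *)
  rewrite ltcE /= => /andP[/eqP -> e0].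
  have e2 : 0 < e / 2 by rewrite divr_gt0.
  apply: filterS2 (ur _ e2) (ui _ e2) => x; rewrite -ReB -ImB => h1 h2.
  rewrite normc_def ltcR.
  have := normc_le (l - u x); case: (l - u x) h1 h2 => a b /= h1 h2 h3.
  by apply: le_lt_trans h3 _; rewrite [ltRHS]splitr ltrD.
Qed.

Lemma cvg_mx_coordP (T : Type) (F : set_system T) (FF : Filter F) m n
    (U : T -> 'M[R[i]]_(m, n)) (L : 'M[R[i]]_(m, n)) :
  U @ F --> L <-> forall i j, U x i j @[x --> F] --> L i j.
Proof.
split=> [UL i j|UL].
  apply: (@cvg_comp _ _ _ U (fun M : 'M[R[i]]_(m, n) => M i j) F (nbhs L))
    => //.
  exact: coord_continuous.
move=> A [P LP PA]; rewrite /nbhs /=.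
have : \forall x \near F, forall i j, P i j (U x i j).
  by apply: filter_forall => i; apply: filter_forall => j; exact: UL.
by apply: filterS => x Px; exact: PA.
Qed.

Lemma cvg_mulmx (T : Type) (F : set_system T) (FF : Filter F) m n p
    (U : T -> 'M[R[i]]_(m, n)) (V : T -> 'M[R[i]]_(n, p))
    (K : 'M[R[i]]_(m, n)) (L : 'M[R[i]]_(n, p)) :
  U @ F --> K -> V @ F --> L -> (fun x => U x *m V x) @ F --> K *m L.
Proof.
move=> /cvg_mx_coordP UK /cvg_mx_coordP VL; apply/cvg_mx_coordP => i j.
under eq_fun do rewrite mxE; rewrite mxE.
apply: cvg_big => [|k _]; first exact: add_continuous.
exact: (cvgM (UK i k) (VL k j)).
Qed.

(** Differentiation is reduced to two real functions, so that the real mean value theorem and real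
    power series apply to each. *)
Definition cderiv (F : R -> R[i]) (t : R) (d : R[i]) : Prop :=
  is_derive t (1 : R) (Re \o F) (Re d) /\
  is_derive t (1 : R) (Im \o F) (Im d).

Lemma cderiv_cvg F t d : cderiv F t d -> F @ t --> F t.
Proof.
move=> [dr di]; apply/cvg_complexP; split.
- by have [/derivable1_diffP/differentiable_continuous] := dr.
- by have [/derivable1_diffP/differentiable_continuous] := di.
Qed.

Lemma cderivM F G t dF dG : cderiv F t dF -> cderiv G t dG ->
  cderiv (fun x => F x * G x) t (dF * G t + F t * dG).
Proof.
move=> [Fr Fi] [Gr Gi]; split.
- rewrite [X in is_derive _ _ X _](_ : _ =
    (Re \o F) * (Re \o G) - (Im \o F) * (Im \o G)).
    apply: (is_derive_eq (is_deriveB (is_deriveM Fr Gr) (is_deriveM Fi Gi))).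
    by rewrite ReD !ReM /GRing.scale /=; ring.
  by apply/funext => x; rewrite /= ReM.
- rewrite [X in is_derive _ _ X _](_ : _ =
    (Re \o F) * (Im \o G) + (Im \o F) * (Re \o G)).
    apply: (is_derive_eq (is_deriveD (is_deriveM Fr Gi) (is_deriveM Fi Gr))).
    by rewrite ImD !ImM /GRing.scale /=; ring.
  by apply/funext => x; rewrite /= ImM.
Qed.

Lemma cderiv_sum n (F : 'I_n -> R -> R[i]) t (dF : 'I_n -> R[i]) :
  (forall i, cderiv (F i) t (dF i)) ->
  cderiv (fun x => \sum_i F i x) t (\sum_i dF i).
Proof.
move=> dFi; split.
- rewrite Re_sum [X in is_derive _ _ X _](_ : _ = \sum_i (Re \o F i)).
    by apply: is_derive_sum => i; have [] := dFi i.
  by apply/funext => x; rewrite /= Re_sum fct_sumE.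
- rewrite Im_sum [X in is_derive _ _ X _](_ : _ = \sum_i (Im \o F i)).
    by apply: is_derive_sum => i; have [] := dFi i.
  by apply/funext => x; rewrite /= Im_sum fct_sumE.
Qed.

(** The chain rule for time reversal, used to differentiate exp((t-s)X) in s. *)
Lemma is_derive_reflect (f : R -> R) t s d :
  is_derive (t - s) (1 : R) f d ->
  is_derive s (1 : R) (fun x => f (t - x)) (- d).
Proof.
move=> df; rewrite -[- d]mulrN1.
have dg : is_derive s (1 : R) (cst t - id) (- 1).
  apply: (is_derive_eq
    (is_deriveB (is_derive_cst t s 1) (is_derive_id s 1))).
  by rewrite sub0r.
exact: (@is_derive1_comp _ f (cst t - id) s d (- 1) df dg).
Qed.

Lemma cderiv_reflect F t s d :
  cderiv F (t - s) d -> cderiv (fun x => F (t - x)) s (- d).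
Proof.
move=> [dr di]; split; case: d dr di => a b /= dr di.
- exact: (@is_derive_reflect (Re \o F)).
- exact: (@is_derive_reflect (Im \o F)).
Qed.

End ComplexTopology.

(** * The matrix exponential and its derivative *)

Section MatrixExponential.
Variables (R : realType) (n : nat).
Implicit Types (X Y : 'M[R[i]]_n.+1) (t : R).

Local Notation Re := (@complex.Re R).
Local Notation Im := (@complex.Im R).
Local Notation normc := (@ComplexField.Normc.normc R).

Lemma normc_sum_le I (r : seq I) (P : pred I) (F : I -> R[i]) :
  normc (\sum_(i <- r | P i) F i) <= \sum_(i <- r | P i) normc (F i).
Proof.
elim/big_ind2 : _ => //; first by rewrite ComplexField.Normc.normc0.
by move=> x x' y y' h h'; rewrite (le_trans (le_normcD _ _)) // lerD.
Qed.

(** [L] is the sum of the moduli of all entries of [X]. It dominates every row sum, so one more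
    factor [X] costs at most a factor [L]. *)
Lemma normc_expr_mx_le X :
  exists L : R, forall p i j, normc ((X ^+ p) i j) <= L ^+ p.
Proof.
pose L := \sum_i \sum_j normc (X i j); exists L.
have L0 : 0 <= L by do 2!(apply: sumr_ge0 => ? _); exact: normc_ge0.
elim=> [|p IH] i j.
  rewrite !expr0 mxE; case: (i == j); first by rewrite ComplexField.Normc.normc1.
  by rewrite ComplexField.Normc.normc0.
rewrite !exprS mxE (le_trans (normc_sum_le _ _ _)) //.
apply: le_trans (_ : (\sum_k normc (X i k)) * L ^+ p <= _); last first.
  rewrite ler_wpM2r ?exprn_ge0 // /L [leRHS](bigD1 i) //= lerDl.
  by do 2!(apply: sumr_ge0 => ? _); exact: normc_ge0.
rewrite mulr_suml; apply: ler_sum => k _.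
by rewrite ComplexField.Normc.normcM ler_wpM2l ?normc_ge0.
Qed.

Lemma geom_bounded_mx (c : R[i] -> R) X Y i j :
  (forall z, `|c z| <= normc z) ->
  geom_bounded (fun p => c ((X ^+ p *m Y) i j)).
Proof.
move=> cle; have [L XL] := normc_expr_mx_le X.
exists (\sum_k normc (Y k j)), L => p; rewrite (le_trans (cle _)) // mxE.
rewrite (le_trans (normc_sum_le _ _ _)) // mulr_suml; apply: ler_sum => k _.
by rewrite ComplexField.Normc.normcM mulrC ler_wpM2l ?normc_ge0.
Qed.

Definition expmx_partial X t : nat -> 'M[R[i]]_n.+1 :=
  series (fun p : nat => (p`!%:R)^-1 *: (t%:C *: X) ^+ p).

Lemma expmx_term_mul_entry X Y t p i j :
  ((p`!%:R)^-1 *: (t%:C *: X) ^+ p *m Y) i j =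
  ((p`!%:R)^-1 * t ^+ p)%:C * (X ^+ p *m Y) i j.
Proof.
rewrite exprZn scalerA -scalemxAl mxE; congr (_ * _).
by rewrite rmorphM fmorphV rmorph_nat rmorphXn.
Qed.

Lemma Re_expmx_partial X Y t i j :
  (fun N => Re ((expmx_partial X t N *m Y) i j)) =
  pseries (egf_coeff (fun p => Re ((X ^+ p *m Y) i j))) t.
Proof.
apply/funext => N; rewrite /expmx_partial /pseries /series /=.
rewrite mulmx_suml summxE Re_sum; apply: eq_bigr => p _.
by rewrite expmx_term_mul_entry ReM /egf_coeff /= mul0r subr0 mulrAC.
Qed.

Lemma Im_expmx_partial X Y t i j :
  (fun N => Im ((expmx_partial X t N *m Y) i j)) =
  pseries (egf_coeff (fun p => Im ((X ^+ p *m Y) i j))) t.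
Proof.
apply/funext => N; rewrite /expmx_partial /pseries /series /=.
rewrite mulmx_suml summxE Im_sum; apply: eq_bigr => p _.
by rewrite expmx_term_mul_entry ImM /egf_coeff /= mul0r addr0 mulrAC.
Qed.

(** A power series form of exp(tX) Y. The factor [Y] is kept because differentiating exp(tX) gives
    exp(tX) X, which is of the same form. *)
Definition expmx_mul X Y t : 'M[R[i]]_n.+1 := \matrix_(i, j)
  (egf (fun p => Re ((X ^+ p *m Y) i j)) t +i*
   egf (fun p => Im ((X ^+ p *m Y) i j)) t).

Lemma cvg_expmx_partial_mul X Y t :
  (fun N => expmx_partial X t N *m Y) @ \oo --> expmx_mul X Y t.
Proof.
apply/cvg_mx_coordP => i j; apply/cvg_complexP; rewrite mxE; split.
- rewrite Re_expmx_partial; apply: is_cvg_egf.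
  exact/geom_bounded_mx/normr_Re_le_normc.
- rewrite Im_expmx_partial; apply: is_cvg_egf.
  exact/geom_bounded_mx/normr_Im_le_normc.
Qed.

Lemma cvg_expmx_partial X t : expmx_partial X t @ \oo --> expmx_mul X 1%:M t.
Proof.
by have := @cvg_expmx_partial_mul X 1%:M t; under eq_fun do rewrite mulmx1.
Qed.

Lemma expmxE X t : expmx (t%:C *: X) = expmx_mul X 1%:M t.
Proof. by apply/cvg_lim; [exact: norm_hausdorff|exact: cvg_expmx_partial]. Qed.

(** Both sides are limits of the partial sums multiplied by [Y], and limits are unique. *)
Lemma expmx_mulE X Y t : expmx_mul X Y t = expmx (t%:C *: X) *m Y.
Proof.
suff : (fun N => expmx_partial X t N *m Y) @ \oo --> expmx (t%:C *: X) *m Y.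
  exact: (cvg_unique (@norm_hausdorff _ _) (@cvg_expmx_partial_mul X Y t)).
apply: cvg_mulmx; last exact: cvg_cst.
by rewrite expmxE; exact: cvg_expmx_partial.
Qed.

(** Differentiation shifts the powers of [X] by one, and X^(p+1) = X^p X turns the shifted series
    into the one with right factor [X]. *)
Lemma cderiv_expmx X t i j :
  cderiv (fun t => expmx (t%:C *: X) i j) t ((expmx (t%:C *: X) *m X) i j).
Proof.
have XS p : X ^+ p *m X = X ^+ p.+1 *m 1%:M by rewrite mulmx1 exprSr.
rewrite -expmx_mulE; split.
- rewrite [X in is_derive _ _ X _](_ : _ =
    egf (fun p => Re ((X ^+ p *m 1%:M) i j))).
    apply: (is_derive_eq (is_derive_egf _ _)).
      exact/geom_bounded_mx/normr_Re_le_normc.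
    by rewrite mxE; congr (egf _ t); apply/funext => p; rewrite XS.
  by apply/funext => s; rewrite /= expmxE mxE.
- rewrite [X in is_derive _ _ X _](_ : _ =
    egf (fun p => Im ((X ^+ p *m 1%:M) i j))).
    apply: (is_derive_eq (is_derive_egf _ _)).
      exact/geom_bounded_mx/normr_Im_le_normc.
    by rewrite mxE; congr (egf _ t); apply/funext => p; rewrite XS.
  by apply/funext => s; rewrite /= expmxE mxE.
Qed.

Lemma expmx0 : expmx (0 : 'M[R[i]]_n.+1) = 1%:M.
Proof.
apply/cvg_lim; first exact: norm_hausdorff.
(* Every partial sum but the empty one equals the identity. *)
apply/cvgrPdist_lt => e e0; exists 1%N => // -[//|N] _ /=.
rewrite /series /= big_mkord big_ord_recl big1 ?addr0; last first.
  by move=> p _; rewrite exprS mul0r scaler0.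
by rewrite expr0 fact0 invr1 scale1r subrr normr0.
Qed.

End MatrixExponential.

(** * The Euclidean norm and the induced matrix norm *)

Section EuclideanNorm.
Variables (R : realType) (n : nat).
Implicit Types (X : 'M[R[i]]_n) (v : 'cV[R[i]]_n).

Local Notation normc := (@ComplexField.Normc.normc R).

Lemma norm2_ge0 v : 0 <= norm2 v.
Proof. exact: sqrtr_ge0. Qed.

Lemma normc_le_norm2 v j : normc (v j ord0) <= norm2 v.
Proof.
rewrite -[leLHS]ger0_norm ?normc_ge0 // -sqrtr_sqr /norm2 ler_sqrt; last first.
  by apply: sumr_ge0 => k _; rewrite sqr_ge0.
by rewrite [leRHS](bigD1 j) //= lerDl sumr_ge0 // => k _; rewrite sqr_ge0.
Qed.

Lemma norm2_le_sum v : norm2 v <= \sum_j normc (v j ord0).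
Proof.
have S0 : 0 <= \sum_j normc (v j ord0).
  by apply: sumr_ge0 => j _; exact: normc_ge0.
rewrite -[leRHS]ger0_norm // -sqrtr_sqr ler_sqrt ?sqr_ge0 //.
rewrite expr2 mulr_suml ler_sum // => j _.
rewrite expr2 ler_wpM2l ?normc_ge0 //.
by rewrite [leRHS](bigD1 j) //= lerDl sumr_ge0 // => k _; exact: normc_ge0.
Qed.

Lemma norm2Z (a : R[i]) v : norm2 (a *: v) = normc a * norm2 v.
Proof.
rewrite -[normc a in RHS]ger0_norm ?normc_ge0 // -sqrtr_sqr -sqrtrM ?sqr_ge0 //.
congr (Num.sqrt _); rewrite mulr_sumr; apply: eq_bigr => j _.
by rewrite mxE ComplexField.Normc.normcM exprMn.
Qed.

Lemma norm2_0 : norm2 (0 : 'cV[R[i]]_n) = 0.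
Proof.
by rewrite -(scale0r (0 : 'cV_n)) norm2Z ComplexField.Normc.normc0 mul0r.
Qed.

Lemma norm2_eq0 v : norm2 v = 0 -> v = 0.
Proof.
move=> v0; apply/matrixP => j l; rewrite ord1 mxE.
apply: ComplexField.Normc.eq0_normc; apply/eqP; rewrite eq_le normc_ge0 andbT.
by rewrite -v0 normc_le_norm2.
Qed.

Lemma norm2_mulmx_le X v : norm2 (X *m v) <= mxnorm2 X * norm2 v.
Proof.
have [/norm2_eq0 ->|v0] := eqVneq (norm2 v) 0.
  by rewrite mulmx0 norm2_0 mulr0.
(* [v] is written as its norm times a unit vector, to which the supremum applies. *)
have vE : v = (norm2 v)%:C *: ((norm2 v)^-1%:C *: v).
  by rewrite scalerA -rmorphM mulfV // scale1r.
set w := _ *: v in vE.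
have w1 : norm2 w = 1.
  by rewrite /w norm2Z normc_real ger0_norm ?invr_ge0 ?norm2_ge0 // mulVf.
rewrite [in leLHS]vE -scalemxAr norm2Z normc_real ger0_norm ?norm2_ge0 //.
rewrite mulrC ler_wpM2r ?norm2_ge0 //; apply: ub_le_sup; last by exists w.
(* An upper bound on the unit sphere: the sum of the moduli of the entries of [X]. It makes [sup] a
   true supremum. *)
exists (\sum_j \sum_k normc (X j k)) => _ [u /= u1 <-].
rewrite (le_trans (norm2_le_sum _)) // ler_sum // => j _.
rewrite mxE (le_trans (normc_sum_le _ _ _)) // ler_sum // => k _.
rewrite ComplexField.Normc.normcM ler_piMr ?normc_ge0 //.
by rewrite -u1 normc_le_norm2.
Qed.

End EuclideanNorm.

(** * From derivatives on the half-line to ordinary ones *)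

Section HalfLine.
Variables (R : realType) (n : nat).
Implicit Types (f : R -> 'cV[R[i]]_n) (t : R).

Local Notation Re := (@complex.Re R).
Local Notation Im := (@complex.Im R).

Global Instance increments_filter t : Filter (increments t).
Proof. exact: within_filter. Qed.

(** For t > 0 all h close to 0 satisfy -t < h, so the restriction on increments is void near 0 and
    the limit is two-sided. *)
Lemma increments_dnbhs t : 0 < t -> forall A, increments t A -> (0 : R)^' A.
Proof.
move=> t0 A; rewrite /increments /within /=; apply: filter_app.
apply: (@cvg_within _ (nbhs (0 : R))).
have : \forall h \near (0 : R), - t < h by apply: lt_nbhsr; rewrite oppr_lt0.
by apply: filterS => h th; apply; rewrite -lerBlDl sub0r ltW.
Qed.

Lemma increments_at_right : forall A, increments (0 : R) A -> (0 : R)^'+ A.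
Proof.
move=> A; rewrite /increments /dnbhs /at_right /within /=.
apply: (@filterS _ (nbhs (0 : R))) => h hA h0.
by apply: hA; rewrite ?gt_eqF //= add0r ltW.
Qed.

Lemma cvg_is_derive (F : R -> R) t d :
  h^-1 * (F (t + h) - F t) @[h --> 0^'] --> d -> is_derive t (1 : R) F d.
Proof.
move=> Fd; have E : (fun h => h^-1 *: (F (h *: 1 + t) - F t)) =
    (fun h => h^-1 * (F (t + h) - F t)).
  by apply/funext => h; rewrite /GRing.scale /= mulr1 [h + t]addrC.
split; first by apply/cvg_ex; exists d; rewrite /= E.
by rewrite /derive E; exact: cvg_lim.
Qed.

Lemma derivable_ge0_cvg f t j : derivable_ge0 f t ->
  diff_quotient f t h j ord0 @[h --> increments t] --> derive_ge0 f t j ord0.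
Proof. by move=> /cvg_mx_coordP /(_ j ord0). Qed.

Lemma derivable_ge0_cderiv f t j : 0 < t -> derivable_ge0 f t ->
  cderiv (fun s => f s j ord0) t (derive_ge0 f t j ord0).
Proof.
move=> t0 /(@derivable_ge0_cvg _ _ j) fl.
have /cvg_complexP[fr fi] : diff_quotient f t h j ord0 @[h --> (0 : R)^'] -->
    derive_ge0 f t j ord0.
  by move=> B /fl; exact: increments_dnbhs.
split; apply: cvg_is_derive.
- refine (cvg_trans _ fr); apply: near_eq_cvg; apply: nearW => h /=.
  by rewrite /diff_quotient 3!mxE ReM ReB /= mul0r subr0.
- refine (cvg_trans _ fi); apply: near_eq_cvg; apply: nearW => h /=.
  by rewrite /diff_quotient 3!mxE ImM ImB /= mul0r addr0.
Qed.

(** For h > 0, f(h) is h times the difference quotient plus f(0); the first term tends to 0 because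
    the quotient converges. *)
Lemma derivable_ge0_cvg_right f : derivable_ge0 f 0 -> f @ 0^'+ --> f 0.
Proof.
move=> df; apply/cvg_mx_coordP => j l; rewrite ord1.
have fl : diff_quotient f 0 h j ord0 @[h --> 0^'+] --> derive_ge0 f 0 j ord0.
  by move=> B /(@derivable_ge0_cvg _ _ j df); exact: increments_at_right.
have idC : h%:C @[h --> (0 : R)^'+] --> (0 : R[i]).
  apply/cvg_complexP; split; last exact: cvg_cst.
  exact: cvg_at_right_filter cvg_id.
have := cvgD (cvgM idC fl) (cvg_cst (f 0 j ord0)).
rewrite mul0r add0r => /(_ _ _ _) H; refine (cvg_trans _ H); apply: near_eq_cvg.
near=> h; have h0 : h != 0 by apply: lt0r_neq0; near: h; exact: nbhs_right_gt.
rewrite /diff_quotient /= fctE /= !mxE add0r mulrA -rmorphM mulfV //.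
by rewrite mul1r subrK.
Unshelve. all: by end_near. Qed.

End HalfLine.

(** * The forced linear system with a decaying forcing term *)

Section Duhamel.
Variable R : realType.

Local Notation Re := (@complex.Re R).
Local Notation Im := (@complex.Im R).
Local Notation normc := (@ComplexField.Normc.normc R).

(** F(s) + (c/mu) e^(-mu s) has nonpositive derivative, so by the mean value theorem F(t) - F(0) <=
    (c/mu)(1 - e^(-mu t)) <= c/mu. *)
Lemma increment_le_exp_decay (F dF : R -> R) (t c mu : R) :
  0 < t -> 0 < mu -> 0 <= c ->
  (forall s, s \in `]0, t[ -> is_derive s (1 : R) F (dF s)) ->
  {within `[0, t], continuous F} ->
  (forall s, s \in `]0, t[ -> dF s <= c * expR (- mu * s)) ->
  F t - F 0 <= c / mu.
Proof.
move=> t0 mu0 c0 dFs cF dFle.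
pose G : R -> R := F + (c / mu) \*: (fun s => expR (- mu * s)).
have dG s : s \in `]0, t[ ->
    is_derive s (1 : R) G (dF s - c * expR (- mu * s)).
  move=> /dFs dFs'.
  have dl : is_derive s (1 : R) (fun x => - mu * x) (- mu).
    have := is_deriveZ (- mu) (is_derive_id s (1 : R)).
    by rewrite /GRing.scale /= mulr1.
  have de := is_derive1_comp (is_derive_expR (- mu * s)) dl.
  apply: (is_derive_eq (is_deriveD dFs' (is_deriveZ (c / mu) de))).
  congr (_ + _); rewrite /GRing.scale /=.
  by field; rewrite gt_eqF.
have cG : {within `[0, t], continuous G}.
  move=> s; apply: cvgD; first exact: cF.
  apply: cvgZl_tmp; apply: continuous_subspaceT => x.
  apply: continuous_comp; last exact: continuous_expR.
  exact: mulrl_continuous.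
have [s st Gt] := MVT t0 dG cG.
have : G t <= G 0.
  rewrite -subr_le0 Gt subr0 pmulr_lle0 // subr_le0; exact: dFle.
rewrite /G !fctE /= mulr0 expR0 /GRing.scale /= mulr1 => Gle.
have := expR_ge0 (- mu * t).
have : 0 <= c / mu by rewrite divr_ge0 // ltW.
move: (c / mu) (expR _) Gle => a e Gle a0 e0.
have := mulr_ge0 a0 e0; lra.
Qed.

Lemma norm_increment_le_exp_decay (F dF : R -> R) (t c mu : R) :
  0 < t -> 0 < mu -> 0 <= c ->
  (forall s, s \in `]0, t[ -> is_derive s (1 : R) F (dF s)) ->
  {within `[0, t], continuous F} ->
  (forall s, s \in `]0, t[ -> `|dF s| <= c * expR (- mu * s)) ->
  `|F t - F 0| <= c / mu.
Proof.
move=> t0 mu0 c0 dFs cF dFle; rewrite ler_norml; apply/andP; split.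
- rewrite lerNl opprB.
  have := @increment_le_exp_decay (- F) (fun s => - dF s) t c mu.
  rewrite !fctE opprK addrC; apply => //.
  + by move=> s /dFs ?; exact: is_deriveN.
  + by move=> s; apply: cvgN; exact: cF.
  + by move=> s /dFle; apply: le_trans; rewrite -normrN ler_norm.
- apply: (@increment_le_exp_decay F dF) => // s /dFle; apply: le_trans.
  exact: ler_norm.
Qed.

Variable n : nat.

(** A forcing term that decays faster than the semigroup by a margin [mu] leaves the rate and the
    polynomial factor of the semigroup unchanged. *)
Lemma duhamel_bound (M : nat) (lambda mu C Kg : R) (X : 'M[R[i]]_n.+1)
    (f g : R -> 'cV[R[i]]_n.+1) :
  0 < mu ->
  (forall t, 0 <= t ->
     mxnorm2 (expmx (t%:C *: X)) <= C * (t ^+ M + 1) * expR (- lambda * t)) ->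
  (forall t, 0 <= t -> derivable_ge0 f t) ->
  (forall t, 0 <= t -> derive_ge0 f t = X *m f t + g t) ->
  (forall t, 0 <= t -> norm2 (g t) <= Kg * expR (- (lambda + mu) * t)) ->
  exists K, forall t, 0 <= t ->
    norm2 (f t) <= K * (t ^+ M + 1) * expR (- lambda * t).
Proof.
move=> mu0 expX df odef gle.
(* [K0] bounds the free evolution of f(0), [K1] each real coordinate of the accumulated forcing.
   Absolute values appear since [C] and [Kg] have no known sign. *)
pose K0 := `|C| * norm2 (f 0).
pose K1 := `|C| * `|Kg| / mu.
have K0_ge0 : 0 <= K0 by rewrite mulr_ge0 ?norm2_ge0.
have K1_ge0 : 0 <= K1 by rewrite divr_ge0 ?mulr_ge0 // ltW.
have K2_ge0 : 0 <= n.+1%:R * (K0 + (K1 + K1)) by rewrite mulr_ge0 // !addr_ge0.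
(* [K1] counts once for the real and once for the imaginary part, n+1 for the coordinates;
   [norm2 (f 0)] settles t = 0, treated apart because the mean value theorem needs a nondegenerate
   interval. *)
exists (norm2 (f 0) + n.+1%:R * (K0 + (K1 + K1))) => t.
rewrite le_eqVlt => /predU1P[<-|t0].
  rewrite mulr0 expR0 mulr1.
  apply: le_trans (_ : norm2 (f 0) * (0 ^+ M + 1) <= _).
    by rewrite ler_peMr ?norm2_ge0 // lerDr exprn_ge0.
  by rewrite ler_wpM2r ?lerDl // addr_ge0 // exprn_ge0.
set W := t ^+ M + 1; set E := expR (- lambda * t).
have W0 : 0 <= W by rewrite addr_ge0 // exprn_ge0 // ltW.
have E0 : 0 <= E := expR_ge0 _.
(* The polynomial factor is frozen at its largest value on [0, t], so only the exponential still
   depends on s. *)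
have expX' s : 0 <= s -> s <= t ->
    mxnorm2 (expmx (s%:C *: X)) <= `|C| * W * expR (- lambda * s).
  move=> s0 st; apply: le_trans (expX s s0) _.
  rewrite ler_wpM2r ?expR_ge0 //.
  have Ws : s ^+ M + 1 <= W by rewrite lerD2r lerXn2r ?nnegrE // (le_trans s0).
  apply: le_trans (_ : `|C| * (s ^+ M + 1) <= _); last by rewrite ler_wpM2l.
  by rewrite ler_wpM2r ?ler_norm // addr_ge0 // exprn_ge0.
pose phi s := expmx ((t - s)%:C *: X) *m f s.
have phit : phi t = f t by rewrite /phi subrr scale0r expmx0 mul1mx.
have phi0 : norm2 (phi 0) <= K0 * W * E.
  rewrite /phi subr0; apply: le_trans (norm2_mulmx_le _ _) _.
  rewrite [leRHS](_ : _ = (`|C| * W * E) * norm2 (f 0)); last first.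
    by rewrite /K0; ring.
  by rewrite ler_wpM2r ?norm2_ge0 // expX' // ltW.
pose dphi s : 'cV[R[i]]_n.+1 := expmx ((t - s)%:C *: X) *m g s.
have dphiP s j : 0 < s -> cderiv (fun s => phi s j ord0) s (dphi s j ord0).
  move=> s0.
  rewrite [X in cderiv X _ _](_ : _ = fun s =>
    \sum_k expmx ((t - s)%:C *: X) j k * f s k ord0); last first.
    by apply/funext => x; rewrite mxE.
  set P := expmx ((t - s)%:C *: X).
  have -> : dphi s j ord0 =
      \sum_k (- (P *m X) j k * f s k ord0 + P j k * derive_ge0 f s k ord0).
    (* Once the equation for f' is inserted, the terms in P X f(s) cancel and only P g(s) is
       left. *)
    have -> : dphi s = (- (P *m X)) *m f s + P *m derive_ge0 f s.
      by rewrite (odef _ (ltW s0)) mulmxDr mulNmx mulmxA addKr.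
    by rewrite mxE !mxE -big_split /=; apply: eq_bigr => k _; rewrite mxE.
  apply: cderiv_sum => k; apply: cderivM.
    apply: (cderiv_reflect (F := fun x => expmx (x%:C *: X) j k)).
    exact: cderiv_expmx.
  by apply: derivable_ge0_cderiv => //; apply: df; exact: ltW.
have dphi_le s j : s \in `]0, t[ ->
    normc (dphi s j ord0) <= (`|C| * `|Kg| * W * E) * expR (- mu * s).
  rewrite in_itv /= => /andP[s0 st].
  apply: le_trans (normc_le_norm2 _ _) _.
  apply: le_trans (norm2_mulmx_le _ _) _.
  have ts : 0 <= t - s by rewrite subr_ge0 ltW.
  have tst : t - s <= t by rewrite lerBlDr lerDl ltW.
  have g' : norm2 (g s) <= `|Kg| * expR (- (lambda + mu) * s).
    apply: le_trans (gle s (ltW s0)) _.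
    by rewrite ler_wpM2r ?expR_ge0 ?ler_norm.
  apply: le_trans (ler_wpM2r (norm2_ge0 _) (expX' _ ts tst)) _.
  apply: le_trans (ler_wpM2l _ g') _.
    by rewrite !mulr_ge0 ?expR_ge0.
  rewrite [leLHS](_ : _ = `|C| * `|Kg| * W *
    (expR (- lambda * (t - s)) * expR (- (lambda + mu) * s))); last by ring.
  (* The exponents agree: -lambda (t - s) - (lambda + mu) s = -lambda t - mu s. *)
  rewrite -expRD.
  rewrite [leRHS](_ : _ = `|C| * `|Kg| * W * (E * expR (- mu * s))); last by ring.
  rewrite -expRD le_eqVlt; apply/orP; left; apply/eqP; congr (_ * expR _); ring.
(* At 0 the solution is differentiable from the right only, which still gives the one-sided
   continuity required on [0, t]. *)
have phi_cvg0 j : phi s j ord0 @[s --> 0^'+] --> phi 0 j ord0.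
  suff /cvg_mx_coordP : phi @ 0^'+ --> phi 0 by apply.
  apply: cvg_mulmx; last exact/derivable_ge0_cvg_right/df.
  apply/cvg_mx_coordP => k l; apply: cvg_at_right_filter.
  apply: cderiv_cvg.
  apply: (cderiv_reflect (F := fun x => expmx (x%:C *: X) k l)).
  exact: cderiv_expmx.
have phi_cvg (s : R) j : 0 < s -> phi x j ord0 @[x --> s] --> phi s j ord0.
  by move=> /dphiP - /(_ j) /cderiv_cvg.
have K1E : `|C| * `|Kg| * W * E / mu = K1 * W * E by rewrite /K1; ring.
have c0 : 0 <= `|C| * `|Kg| * W * E by rewrite !mulr_ge0.
have incRe j : `|Re (phi t j ord0) - Re (phi 0 j ord0)| <= K1 * W * E.
  rewrite -K1E.
  apply: (@norm_increment_le_exp_decay (fun s => Re (phi s j ord0))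
    (fun s => Re (dphi s j ord0))) => //.
  - by move=> s; rewrite in_itv /= => /andP[s0 _]; have [] := dphiP s j s0.
  - apply/continuous_within_itvP => //; split.
    + move=> s; rewrite in_itv /= => /andP[s0 _].
      by have /cvg_complexP[] := phi_cvg s j s0.
    + by have /cvg_complexP[] := phi_cvg0 j.
    + apply: cvg_at_left_filter.
      by have /cvg_complexP[] := phi_cvg t j t0.
  - by move=> s st; apply: le_trans (dphi_le s j st); exact: normr_Re_le_normc.
have incIm j : `|Im (phi t j ord0) - Im (phi 0 j ord0)| <= K1 * W * E.
  rewrite -K1E.
  apply: (@norm_increment_le_exp_decay (fun s => Im (phi s j ord0))
    (fun s => Im (dphi s j ord0))) => //.
  - by move=> s; rewrite in_itv /= => /andP[s0 _]; have [] := dphiP s j s0.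
  - apply/continuous_within_itvP => //; split.
    + move=> s; rewrite in_itv /= => /andP[s0 _].
      by have /cvg_complexP[] := phi_cvg s j s0.
    + by have /cvg_complexP[] := phi_cvg0 j.
    + apply: cvg_at_left_filter.
      by have /cvg_complexP[] := phi_cvg t j t0.
  - by move=> s st; apply: le_trans (dphi_le s j st); exact: normr_Im_le_normc.
apply: le_trans (_ : n.+1%:R * (K0 + (K1 + K1)) * W * E <= _); last first.
  by rewrite !ler_wpM2r // lerDr norm2_ge0.
rewrite -phit; apply: le_trans (norm2_le_sum _) _.
rewrite -!mulrA -[n.+1 in leRHS]card_ord mulr_natl -sumr_const.
apply: ler_sum => j _.
(* Each coordinate of f(t) is split into its initial value phi(0) and the increment of phi. *)
rewrite -[phi t j ord0](subrK (phi 0 j ord0)) addrC.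
apply: le_trans (le_normcD _ _) _; rewrite (mulrDl K0) (mulrDl K1); apply: lerD.
  apply: le_trans (normc_le_norm2 _ _) _. by rewrite mulrA.
apply: le_trans (normc_le _) _; rewrite ReB ImB !mulrA.
by apply: lerD.
Qed.

End Duhamel.

(** * Polynomials absorbed by exponentials *)

Section PolynomialBounds.
Variable R : realType.

(** Induction on [M]: half of the rate absorbs t^M, the other half the additional factor t through 1
    + x <= e^x. *)
Lemma exprn_le_expR (M : nat) (mu : R) : 0 < mu ->
  exists K : R, forall t, 0 <= t -> t ^+ M <= K * expR (mu * t).
Proof.
elim: M mu => [|M IH] mu mu0.
  exists 1 => t t0; rewrite expr0 mul1r -expR0 ler_expR mulr_ge0 //; exact: ltW.
have mu2 : 0 < mu / 2 by rewrite divr_gt0.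
have [K KP] := IH _ mu2; exists (K * (mu / 2)^-1) => t t0.
rewrite [mu in expR (mu * _)]splitr mulrDl expRD exprSr mulrACA.
apply: ler_pM => //; [exact: exprn_ge0|exact: KP|].
rewrite ler_pdivlMl //.
by rewrite (le_trans _ (expR_ge1Dx _)) // lerDr.
Qed.

Lemma sqr_exprnD1_le_expR (M : nat) (mu : R) : 0 < mu ->
  exists K : R, forall t, 0 <= t -> (t ^+ M + 1) ^+ 2 <= K * expR (mu * t).
Proof.
move=> mu0; have mu2 : 0 < mu / 2 by rewrite divr_gt0.
have [K KP] := exprn_le_expR M mu2; exists ((K + 1) ^+ 2) => t t0.
rewrite [mu in expR (mu * _)]splitr mulrDl expRD -expr2 -exprMn lerXn2r //.
- by rewrite nnegrE addr_ge0 // exprn_ge0.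
- rewrite nnegrE mulr_ge0 ?expR_ge0 // addr_ge0 //.
  (* [K] is nonnegative, as the bound at t = 0 shows. *)
  have := KP 0 (lexx _); rewrite mulr0 expR0 mulr1; apply: le_trans.
  exact: exprn_ge0.
- rewrite mulrDl mul1r lerD ?KP // -[leLHS]expR0 ler_expR.
  by rewrite mulr_ge0 // ltW.
Qed.

End PolynomialBounds.

(** * Decay of all modes, by induction on the mode number *)

Theorem theorem5 (R : realType) (M : nat) (hM : (1 <= M)%N)
  (D k : R) (hD : 0 < D) (hk : k = 2 * pi / D)
  (h : 'I_M.+1 -> R) (h_le0 : forall i, h i <= 0)
  (h_first : h ord0 = 0) (h_last : h ord_max <> 0)
  (lambda1 : R) (hlambda1 : 0 < lambda1)
  (hspec : forall m : int, m <> 0 ->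
     forall a : R[i], eigenvalue (mxGm k h m) a -> complex.Re a < - lambda1)
  (hexp : exists C4 : R, forall m : int, m <> 0 -> forall t : R, 0 <= t ->
     mxnorm2 (expmx (t%:C *: mxGm k h m))
       <= C4 * (t ^+ M + 1) * expR (- lambda1 * t))
  (f : nat -> R -> 'cV[R[i]]_M.+1)
  (f_derivable : forall m : nat, (1 <= m)%N ->
     forall t : R, 0 <= t -> derivable_ge0 (f m) t)
  (f1_ode : forall t : R, 0 <= t ->
     derive_ge0 (f 1%N) t
     + ('i%C * k%:C) *: ((mxA R M + ((k ^+ 2)^-1)%:C *: mxG R M) *m f 1%N t)
     = mxH h *m f 1%N t)
  (f1_init : f 1%N 0 = delta_mx ord0 ord0)
  (fm_ode : forall m : nat, (2 <= m)%N -> forall t : R, 0 <= t ->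
     derive_ge0 (f m) t
     + ('i%C * (m%:R * k)%:C) *:
         ((mxA R M + (((m%:R * k) ^+ 2)^-1)%:C *: mxG R M) *m f m t)
     + ('i%C / k%:C) *: (\sum_(1 <= l < m)
         (l%:R^-1 * f l t ord0 ord0) *: (mxB R M *m f (m - l)%N t))
     = mxH h *m f m t)
  (fm_init : forall m : nat, (2 <= m)%N -> f m 0 = 0) :
  forall m : nat, (1 <= m)%N ->
    exists K : R, forall t : R, 0 <= t ->
      norm2 (f m t) <= K * (t ^+ M + 1) * expR (- lambda1 * t).
Proof.
(* For m = 1 the sum is empty and [g] vanishes, so a single equation covers the first mode and the
   later ones. *)
pose g m t : 'cV[R[i]]_M.+1 := - (('i%C / k%:C) *: (\sum_(1 <= l < m)
         (l%:R^-1 * f l t ord0 ord0) *: (mxB R M *m f (m - l)%N t))).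
have ode m t : (1 <= m)%N -> 0 <= t ->
    derive_ge0 (f m) t = mxGm k h (Posz m) *m f m t + g m t.
  move=> m1 t0.
  have : derive_ge0 (f m) t
     + ('i%C * (m%:R * k)%:C) *:
         ((mxA R M + (((m%:R * k) ^+ 2)^-1)%:C *: mxG R M) *m f m t)
     - g m t = mxH h *m f m t.
    rewrite /g opprK; case: m m1 => [//|[_|m _]]; last exact: fm_ode.
    by rewrite big_geq // scaler0 addr0 mul1r f1_ode.
  rewrite /mxGm scaleNr [(- _ + _) *m _]mulmxDl mulNmx -scalemxAl => <-.
  by rewrite -pmulrn -addrA subrK addrC addrK.
(* The quadratic term decays at rate 2 [lambda1] up to a squared polynomial. Giving up [lambda1 / 2]
   to absorb the latter leaves a margin of [lambda1 / 2] over the semigroup. *)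
have lam2 : 0 < lambda1 / 2 by rewrite divr_gt0.
have [Kp KpP] := sqr_exprnD1_le_expR M lam2.
have [C4 C4P] := hexp.
(* One constant for all modes up to m, because the convolution involves all the preceding modes. *)
suff H m : exists K, forall l, (1 <= l <= m)%N -> forall t, 0 <= t ->
    norm2 (f l t) <= K * (t ^+ M + 1) * expR (- lambda1 * t).
  by move=> m m1; have [K KP] := H m; exists K; apply: KP; rewrite m1 leqnn.
elim: m => [|m [K KP]].
  by exists 0 => -[|l].
have [K' KP'] : exists K', forall t, 0 <= t ->
    norm2 (f m.+1 t) <= K' * (t ^+ M + 1) * expR (- lambda1 * t).
  (* [Kg] bounds each coordinate of the forcing: [K ^+ 2] comes from the two modes in each product,
     [Kp] from the squared polynomial. The factor M+1 used below passes from coordinates to the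
     norm. *)
  pose Kg : R := ComplexField.Normc.normc ('i%C / k%:C : R[i]) *
    \sum_(1 <= l < m.+1) ComplexField.Normc.normc (l%:R^-1 : R[i]) *
      (`|mxnorm2 (mxB R M)| * (K ^+ 2 * Kp)).
  apply: (@duhamel_bound R M M lambda1 (lambda1 / 2) C4 (M.+1%:R * Kg) _
    (f m.+1) (g m.+1) lam2 (fun t t0 => C4P (Posz m.+1) _ t t0)) => //.
  - by move=> t t0; exact: f_derivable.
  - by move=> t t0; exact: ode.
  - move=> t t0; apply: le_trans (norm2_le_sum _) _.
    rewrite -mulrA mulr_natl -[in leRHS](card_ord M.+1) -sumr_const.
    apply: ler_sum => j _; rewrite /Kg -mulrA /g mxE normcN mxE summxE.
    rewrite ComplexField.Normc.normcM ler_wpM2l ?normc_ge0 //.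
    rewrite (le_trans (normc_sum_le _ _ _)) // mulr_suml.
    rewrite big_nat [leRHS]big_nat; apply: ler_sum => l /andP[l1 lm].
    rewrite mxE !ComplexField.Normc.normcM -!mulrA ler_wpM2l ?normc_ge0 //.
    have fl := KP l (introT andP (conj l1 lm)) t t0.
    have fml : norm2 (f (m.+1 - l)%N t) <=
        K * (t ^+ M + 1) * expR (- lambda1 * t).
      by apply: KP => //; rewrite subn_gt0 lm leq_subLR -addn1 addnC leq_add2r.
    set B := K * _ * _ in fl fml.
    (* No sign of [K] is known, but [B] dominates a norm. *)
    have B0 : 0 <= B := le_trans (norm2_ge0 _) fl.
    apply: le_trans (_ : B * (`|mxnorm2 (mxB R M)| * B) <= _).
      apply: ler_pM; rewrite ?normc_ge0 //.
        exact: le_trans (normc_le_norm2 _ _) fl.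
      apply: le_trans (normc_le_norm2 _ _) _.
      apply: le_trans (norm2_mulmx_le _ _) _.
      apply: le_trans
        (_ : `|mxnorm2 (mxB R M)| * norm2 (f (m.+1 - l)%N t) <= _).
        by rewrite ler_wpM2r ?norm2_ge0 // ler_norm.
      by rewrite ler_wpM2l.
    rewrite mulrCA ler_wpM2l // /B.
    rewrite [leLHS](_ : _ = K ^+ 2 * ((t ^+ M + 1) ^+ 2 *
      (expR (- lambda1 * t) * expR (- lambda1 * t)))); last by ring.
    rewrite -expRD [leRHS]mulrA ler_wpM2l ?sqr_ge0 //.
    (* The rates add up to lambda1/2 - 2 lambda1 = -(lambda1 + lambda1/2). *)
    apply: le_trans (ler_wpM2r (expR_ge0 _) (KpP t t0)) _.
    rewrite -[leLHS]mulrA -expRD le_eqVlt; apply/orP; left; apply/eqP.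
    congr (_ * expR _); lra.
(* This sum dominates both the constant of the earlier modes and that of the new one. *)
exists (`|K| + `|K'|) => l /andP[l1]; rewrite leq_eqVlt => /predU1P[->|lm] t t0.
  apply: le_trans (KP' t t0) _.
  rewrite -!mulrA ler_wpM2r ?(mulr_ge0,expR_ge0,addr_ge0,exprn_ge0) //.
  by rewrite (le_trans (ler_norm _)) // lerDr.
apply: le_trans (KP l _ t t0) _; first by rewrite l1.
rewrite -!mulrA ler_wpM2r ?(mulr_ge0,expR_ge0,addr_ge0,exprn_ge0) //.
by rewrite (le_trans (ler_norm _)) // lerDl.
Qed.
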